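(* Let $\theta\leq\frac14$ be real and let $h,\tau,\hbar,\rho_\infty,B_\infty>0$, $V_\infty\in\mathbb{R}$. Put $$\hat a=\hat a_0+i\hat a_1,\quad \hat a_0=\frac{V_\infty}{\hbar^2B_\infty},\quad \hat a_1=\frac{2\rho_\infty}{\tau\hbar B_\infty}>0,$$ $$\hat\alpha_\theta=2\hat a+(1-4\theta)h^2\hat a^2,\qquad \hat\beta_\theta=2\hat a_0+(1-4\theta)h^2|\hat a|^2 .$$ Then $\hat\alpha_\theta\neq0$, and with $$c_{0\theta}=-\frac{|\hat\alpha_\theta|^{1/2}}{2}e^{-i(\arg_0\hat\alpha_\theta)/2},\qquad \varkappa_\theta=-e^{i\arg\hat\alpha_\theta},\qquad \mu_\theta=\frac{\hat\beta_\theta}{|\hat\alpha_\theta|}$$ one has $\mu_\theta\in(-1,1)$, and the operator $\mathcal{S}_{\mathrm{ref}\,\theta}$ of the discrete transparent boundary condition (defined in the context) has the discrete convolution form $$\mathcal{S}_{\mathrm{ref}\,\theta}^m\mathbf{\Phi}^m=c_{0\theta}\,(R(\varkappa_\theta,\mu_\theta)*\Phi)^m\equiv c_{0\theta}\sum_{l=0}^mR^l(\varkappa_\theta,\mu_\theta)\,\Phi^{m-l},\qquad m\geq1,$$ for any $\Phi:\{t_m\}_{m\geq0}\to\mathbb{C}$ such that $\Phi^0=0$, where $$R^m(\varkappa,\mu):=-\frac{\varkappa^m}{2m-1}\left[P_m(\mu)-P_{m-2}(\mu)\right],\qquad m\geq0 .$$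
   Context: $P_m$ are the classical Legendre polynomials, extended by $P_m=0$ for $m<0$. For $z\in\mathbb{C}\setminus\{0\}$, $\arg z$ is defined up to $2\pi k$ with any integer $k$, whereas $\arg_0z\in[0,2\pi)$. The time mesh is $t_m=m\tau$, $m\geq0$; $\overline{\partial}_tY^m=\frac{Y^m-Y^{m-1}}{\tau}$ and $\overline{s}_tY^m=\frac{Y^{m-1}+Y^m}{2}$ for $m\geq1$. For $\Phi$ on the time mesh, $\mathbf{\Phi}^m=\{\Phi^l\}_{l=1}^m$. Setting. A family (parameter $\theta\leq\frac14$) of Crank-Nicolson type finite-difference schemes on the half-axis is considered for the generalized Schrödinger equation $i\hbar\rho D_t\psi=-\frac{\hbar^2}{2}D(BD\psi)+V\psi$, where the coefficients are constant, $\rho=\rho_\infty>0$, $B=B_\infty>0$, $V=V_\infty\in\mathbb{R}$, and the initial function vanishes, for $x\geq X_0$. The space mesh $x_0=0<x_1<\dots$ has $x_J=X>X_0$, and has constant step $h=x_J-x_{J-1}\le X-X_0$ for all steps $x_j-x_{j-1}$ with $j\geq J$. Consequently, at the nodes $x_j$ with $j\geq J$ the scheme is $$i\hbar\rho_\infty\,C_\theta\overline{\partial}_t\Psi_j^m=-\frac{\hbar^2}{2}B_\infty\,\frac{\overline{s}_t\Psi_{j+1}^m-2\overline{s}_t\Psi_j^m+\overline{s}_t\Psi_{j-1}^m}{h^2}+V_\infty C_\theta\overline{s}_t\Psi_j^m,\qquad j\geq J,\ m\geq1,\qquad(\ast)$$ where $C_\theta W_j:=\theta W_{j-1}+(1-2\theta)W_j+\theta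 W_{j+1}$, and $\Psi_j^0=0$ for $j\geq J-1$. Discrete transparent boundary condition (DTBC). The operator $\mathcal{S}_{\mathrm{ref}\,\theta}$ is the one for which $$\frac{\hbar^2}{2}B_\infty\,\frac{\overline{s}_t\Psi_J^m-\overline{s}_t\Psi_{J-1}^m}{h}-h\,s^-_{x\theta}\left(i\hbar\rho_\infty\overline{\partial}_t\Psi-V_\infty\overline{s}_t\Psi\right)_J^m=\frac{\hbar^2}{2}B_\infty\,\mathcal{S}_{\mathrm{ref}\,\theta}^m\mathbf{\Psi}_J^m,\quad m\geq1,$$ with $s^-_{x\theta}W_J:=\theta W_{J-1}+\left(\frac12-\theta\right)W_J$ and $\mathbf{\Psi}_J^m=\{\Psi_J^l\}_{l=1}^m$, is the exact boundary condition satisfied at $x_J$ by the decaying solutions. That is: given $\Phi$ with $\Phi^0=0$, let $\Psi_j^m$ ($j\geq J-1$, $m\geq0$) be the solution of $(\ast)$ with $\Psi^0_j=0$ for $j\geq J-1$, $\Psi_J^m=\Phi^m$, and $\sum_{j\geq J}|\Psi_j^m|^2<\infty$ for every $m$; then $\mathcal{S}_{\mathrm{ref}\,\theta}^m\mathbf{\Phi}^m$ is $\frac{2}{\hbar^2B_\infty}$ times the left-hand side of the boundary condition. *)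

(* Defs.v *)
From mathcomp Require Import all_boot all_order all_algebra.
From mathcomp Require Import all_classical all_reals all_analysis.
From mathcomp Require Import complex.

Set Implicit Arguments.
Unset Strict Implicit.
Unset Printing Implicit Defensive.

Import Order.TTheory GRing.Theory Num.Theory ComplexField.Normc.

Local Open Scope classical_set_scope.
Local Open Scope ring_scope.
Local Open Scope complex_scope.

Definition expi (R : realType) (phi : R) : R[i] := cos phi +i* sin phi.

(* The multivalued argument of z != 0, as the set of all its values. *)
Definition arg (R : realType) (z : R[i]) : set R :=
  [set phi | z = (normc z)%:C * expi phi].

(* For z != 0, the only value of the argument in [0, 2 pi); junk at z = 0. *)
Definition arg0 (R : realType) (z : R[i]) : R :=
  xget 0 (arg z `&` [set phi | 0 <= phi < 2 * pi]).

(* Rodrigues' formula. *)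
Definition legendre_nat (R : realType) (n : nat) : {poly R} :=
  (2 ^+ n * n`!%:R)^-1 *: (('X^2 - 1) ^+ n)^`(n).

Definition legendre (R : realType) (m : int) : {poly R} :=
  if m is Posz n then legendre_nat R n else 0.

Definition Rker (R : realType) (kappa : R[i]) (mu : R) (m : nat) : R[i] :=
  - (kappa ^+ m / (2 * m%:Z - 1)%:~R)
    * ((legendre R m%:Z).[mu] - (legendre R (m%:Z - 2)).[mu])%:C.

Definition dconv (R : realType) (K Phi : nat -> R[i]) (m : nat) : R[i] :=
  \sum_(0 <= l < m.+1) K l * Phi (m - l)%N.

(* Mesh functions in time are sequences indexed by m (for t_m = m tau); the
   two time operators are meant for m >= 1 only. *)
Definition dtbar (R : realType) (tau : R) (Y : nat -> R[i]) (m : nat) : R[i] :=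
  (Y m - Y m.-1) / tau%:C.

Definition stbar (R : realType) (Y : nat -> R[i]) (m : nat) : R[i] :=
  (Y m.-1 + Y m) / 2.

(* The two space operators are meant for j >= 1 only. *)
Definition Ctheta (R : realType) (theta : R) (W : nat -> R[i]) (j : nat) : R[i] :=
  theta%:C * W j.-1 + (1 - 2 * theta)%:C * W j + theta%:C * W j.+1.

Definition sxminus (R : realType) (theta : R) (W : nat -> R[i]) (j : nat) : R[i] :=
  theta%:C * W j.-1 + (2^-1 - theta)%:C * W j.

(* Below, Psi j m is the value at the node x_j and the time t_m; only the nodes
   j >= J - 1 matter. *)
Definition scheme (R : realType) (theta h tau hbar rho B V : R)
    (Psi : nat -> nat -> R[i]) (j m : nat) : Prop :=
  'i * (hbar * rho)%:C * Ctheta theta (fun k => dtbar tau (Psi k) m) j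
  = - (hbar ^+ 2 / 2 * B)%:C
      * ((stbar (Psi j.+1) m - 2 * stbar (Psi j) m + stbar (Psi j.-1) m)
         / (h ^+ 2)%:C)
    + V%:C * Ctheta theta (fun k => stbar (Psi k) m) j.

Definition decaying_solution (R : realType) (theta h tau hbar rho B V : R)
    (J : nat) (Psi : nat -> nat -> R[i]) : Prop :=
  [/\ forall j, (J.-1 <= j)%N -> Psi j 0%N = 0,
      forall j m, (J <= j)%N -> (1 <= m)%N ->
        scheme theta h tau hbar rho B V Psi j m
    & forall m, (\sum_(J <= j <oo) (normc (Psi j m) ^+ 2)%:E < +oo)%E].

Definition dtbc_lhs (R : realType) (theta h tau hbar rho B V : R)
    (J : nat) (Psi : nat -> nat -> R[i]) (m : nat) : R[i] :=
  (hbar ^+ 2 / 2 * B)%:C * ((stbar (Psi J) m - stbar (Psi J.-1) m) / h%:C)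
  - h%:C * sxminus theta
      (fun k => 'i * (hbar * rho)%:C * dtbar tau (Psi k) m
                - V%:C * stbar (Psi k) m) J.

(* The time history {Phi^l}_{l=1}^m; the value Phi^0 is dropped. *)
Definition history (R : realType) (Phi : nat -> R[i]) (m : nat) :
  {ffun 'I_m -> R[i]} := [ffun l : 'I_m => Phi l.+1].

Definition time_operator (R : realType) : Type :=
  forall m : nat, {ffun 'I_m -> R[i]} -> R[i].

Definition exact_dtbc (R : realType) (theta h tau hbar rho B V : R)
    (J : nat) : set (time_operator R) :=
  [set S | forall Psi, decaying_solution theta h tau hbar rho B V J Psi ->
     forall m, (1 <= m)%N ->
       dtbc_lhs theta h tau hbar rho B V J Psi m
       = (hbar ^+ 2 / 2 * B)%:C * S m (history (Psi J) m)].

(* "The" operator of the exact boundary condition, by definite description; the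
   default value is arbitrary. *)
Definition Sref (R : realType) (theta h tau hbar rho B V : R) (J : nat) :
  time_operator R :=
  xget (fun m _ => 0) (exact_dtbc theta h tau hbar rho B V J).

(* Main.v *)
(* In generating functions in time, [P = (1 + z) - 2 h^2 theta (conj a + a z)] and
   [Q = h^2 (conj a + a z)], the scheme reads
   [P (Y_(j+1) + Y_(j-1)) = 2 (P + Q) Y_j] and the boundary operator, up to the
   factor [hbar^2 B / 2], is [(P (Y_J - Y_(J-1)) + Q Y_J) / (2 h)].
   Let [K] be the square root of
   [Q (2 P + Q) / (4 h^2) = (conj alpha + 2 beta z + alpha z^2) / 4] with
   [K(0) = c0], and let [M, N = P + Q +- 2 h K]; then [M N = P^2], and the
   characteristic roots of the scheme are [M / P] and [N / P].  As [Im c0 > 0],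
   [|M(0)| < |P(0)| < |N(0)|], so square summability in [j] kills the [N / P]
   mode: [N Y_J = P Y_(J-1)], and the boundary operator becomes multiplication by
   [K].  Finally [K = c0 sqrt(1 - 2 mu kappa z + kappa^2 z^2)], whose coefficients
   follow from the generating function [(1 - 2 mu z + z^2)^(-1/2)] of the Legendre
   polynomials. *)

Require Import Defs.
From HB Require Import structures.
From mathcomp Require Import all_boot all_order all_algebra.
From mathcomp Require Import all_classical all_reals all_analysis.
From mathcomp Require Import complex.
From mathcomp Require Import zify ring lra.

Set Implicit Arguments.
Unset Strict Implicit.
Unset Printing Implicit Defensive.

Import Order.TTheory GRing.Theory Num.Theory ComplexField.Normc.
Import numFieldNormedType.Exports.

Local Open Scope classical_set_scope.
Local Open Scope ring_scope.
Local Open Scope complex_scope.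

(** * Formal power series *)

(** A bare alias of sequences: a mesh function in time is then its own generating function, while
    [*] on [fps] is the Cauchy product. *)
Definition fps (F : comNzRingType) : Type := nat -> F.

HB.instance Definition _ (F : comNzRingType) := gen_eqMixin (fps F).
HB.instance Definition _ (F : comNzRingType) := gen_choiceMixin (fps F).

Section FpsRing.
Variable F : comNzRingType.
Implicit Types f g k : fps F.

Definition fps_const (c : F) : fps F := fun n => if n is 0%N then c else 0.
Definition fpsX : fps F := fun n => (n == 1%N)%:R.

Definition fps_add f g : fps F := fun n => f n + g n.
Definition fps_opp f : fps F := fun n => - f n.
Definition fps_mul f g : fps F := fun n => \sum_(i < n.+1) f i * g (n - i)%N.

Let fps_addA : associative fps_add.
Proof. by move=> f g k; apply/funext => n; apply: addrA. Qed.
Let fps_addC : commutative fps_add.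
Proof. by move=> f g; apply/funext => n; apply: addrC. Qed.
Let fps_add0 : left_id (fun=> 0 : F) fps_add.
Proof. by move=> f; apply/funext => n; apply: add0r. Qed.
Let fps_addN : left_inverse (fun=> 0 : F) fps_opp fps_add.
Proof. by move=> f; apply/funext => n; apply: addNr. Qed.

HB.instance Definition _ :=
  GRing.isZmodule.Build (fps F) fps_addA fps_addC fps_add0 fps_addN.

(** Truncation carries associativity and commutativity over from [{poly F}]. *)
Let fps_mul_coef N f g n : (n < N)%N ->
  fps_mul f g n = ((\poly_(i < N) f i) * (\poly_(i < N) g i))`_n.
Proof.
move=> ltnN; rewrite coefM; apply: eq_bigr => i _; rewrite !coef_poly.
rewrite (leq_ltn_trans (leq_subr _ _) ltnN).
by rewrite (leq_ltn_trans _ ltnN) // -ltnS.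
Qed.

Let fps_mulA : associative fps_mul.
Proof.
move=> f g k; apply/funext => n; pose p (u : fps F) := \poly_(i < n.+1) u i.
have pE u i : (i < n.+1)%N -> u i = (p u)`_i by move=> lti; rewrite coef_poly lti.
transitivity ((p f * (p g * p k))`_n).
  rewrite coefM; apply: eq_bigr => i _.
  by rewrite -pE // -fps_mul_coef // ltnS leq_subr.
rewrite mulrA coefM; apply: eq_bigr => i _.
by rewrite -fps_mul_coef // -pE // ltnS leq_subr.
Qed.

Let fps_mulC : commutative fps_mul.
Proof.
by move=> f g; apply/funext => n; rewrite !(@fps_mul_coef n.+1) // mulrC.
Qed.

Let fps_mul1 : left_id (fps_const 1) fps_mul.
Proof.
move=> f; apply/funext => n; rewrite /fps_mul big_ord_recl /= subn0 mul1r.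
by rewrite big1 ?addr0 // => i _; rewrite mul0r.
Qed.

Let fps_mulDl : left_distributive fps_mul fps_add.
Proof.
move=> f g k; apply/funext => n; rewrite /fps_add /fps_mul -big_split /=.
by apply: eq_bigr => i _; rewrite mulrDl.
Qed.

Let fps_1neq0 : fps_const 1 != (fun=> 0).
Proof. by apply/eqP => /(congr1 (@^~ 0%N)) /eqP; rewrite oner_eq0. Qed.

HB.instance Definition _ := GRing.Zmodule_isComNzRing.Build (fps F)
  fps_mulA fps_mulC fps_mul1 fps_mulDl fps_1neq0.

Lemma fps1E n : (1 : fps F) n = (n == 0%N)%:R. Proof. by case: n. Qed.
Lemma fpsDE f g n : (f + g) n = f n + g n. Proof. by []. Qed.
Lemma fpsNE f n : (- f) n = - f n. Proof. by []. Qed.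
Lemma fpsME f g n : (f * g) n = \sum_(i < n.+1) f i * g (n - i)%N.
Proof. by []. Qed.

Lemma fpsCM c f n : (fps_const c * f) n = c * f n.
Proof.
rewrite fpsME big_ord_recl /= subn0.
by rewrite big1 ?addr0 // => i _; rewrite mul0r.
Qed.

Lemma fpsXM f n : (fpsX * f) n = if n is k.+1 then f k else 0.
Proof.
case: n => [|n]; first by rewrite fpsME big_ord1 mul0r.
rewrite fpsME big_ord_recl mul0r add0r big_ord_recl mul1r subSS subn0.
by rewrite big1 ?addr0 // => i _; rewrite mul0r.
Qed.

Lemma fpsM0 f g : (f * g) 0%N = f 0%N * g 0%N.
Proof. by rewrite fpsME big_ord1. Qed.

Fact fps_const_zmod_morphism : zmod_morphism fps_const.
Proof. by move=> x y; apply/funext => -[|n]; rewrite fpsDE fpsNE //= subr0. Qed.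
Fact fps_const_monoid_morphism : monoid_morphism fps_const.
Proof.
split=> // x y; apply/funext => n; rewrite fpsCM.
by case: n => //= n; rewrite mulr0.
Qed.
HB.instance Definition _ := GRing.isZmodMorphism.Build F (fps F) fps_const
  fps_const_zmod_morphism.
HB.instance Definition _ := GRing.isMonoidMorphism.Build F (fps F) fps_const
  fps_const_monoid_morphism.

(* The derivation [X d/dX]. *)
Definition fps_euler f : fps F := fun n => n%:R * f n.

Lemma fps_eulerM f g : fps_euler (f * g) = fps_euler f * g + f * fps_euler g.
Proof.
apply/funext => n; rewrite fpsDE /fps_euler !fpsME mulr_sumr -big_split /=.
apply: eq_bigr => i _; rewrite -{1}(subnKC (ltnSE (ltn_ord i))) natrD; ring.
Qed.

End FpsRing.

(** * Legendre polynomials and their generating function *)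

Lemma derivnXM (F : comNzRingType) (p : {poly F}) n :
  ('X * p)^`(n.+1) = 'X * p^`(n.+1) + p^`(n) *+ n.+1.
Proof.
elim: n => [|n IHn]; first by rewrite derivn1 derivM derivX mul1r addrC.
by rewrite derivnS IHn derivD derivM derivX mul1r derivMn -!derivnS; ring.
Qed.

Section Legendre.
Variable R : realType.

Let u : {poly R} := 'X^2 - 1.
Let du : u^`() = 'X *+ 2.
Proof. by rewrite derivB derivXn derivC subr0 expr1. Qed.

Let du_exp n : (u ^+ n.+1)^`() = 'X * u ^+ n *+ (2 * n.+1).
Proof. by rewrite deriv_exp du -mulrnAl -mulrnA -mulrnAl. Qed.

Let d2u_exp n : (u ^+ n.+2)^`()^`()
  = u ^+ n.+1 *+ (2 * n.+2 * (2 * n.+1 + 1)) + u ^+ n *+ (4 * n.+1 * n.+2).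
Proof.
rewrite du_exp derivMn derivM derivX du_exp exprS.
(* X^2 = u + 1 eliminates X, leaving powers of u only. *)
have -> : 'X * ('X * u ^+ n *+ (2 * n.+1)) = (u + 1) * u ^+ n *+ (2 * n.+1).
  by rewrite /u subrK mulrnAr mulrA.
by move: (u ^+ n) u => w v; ring.
Qed.

Let legendre_lead n : 2 ^+ n * n`!%:R != 0 :> R.
Proof. by rewrite mulf_neq0 ?expf_neq0 ?pnatr_eq0 // -lt0n fact_gt0. Qed.

(** With [E] the normalised n-th derivative of u^(n+1), carrying out one or two of the derivatives
    in Rodrigues' formula gives P_(n+2) = x P_(n+1) + (n+1) E and P_(n+2) = P_n + (2n+3) E.
    Eliminating [E] yields Bonnet's recurrence. *)
Lemma legendre_rec (x : R) n :
  n.+2%:R * (legendre_nat R n.+2).[x]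
  = (2 * n.+1 + 1)%:R * x * (legendre_nat R n.+1).[x]
    - n.+1%:R * (legendre_nat R n).[x].
Proof.
pose E := (2 ^+ n.+1 * n.+1`!%:R)^-1 * ((u ^+ n.+1)^`(n)).[x].
have n1 : 1 + n%:R != 0 :> R by rewrite nat1r pnatr_eq0.
have n2 : 2 + n%:R != 0 :> R by rewrite -natrD pnatr_eq0.
have := legendre_lead n; rewrite mulf_eq0 negb_or => /andP[L1 L2].
have e1 : (legendre_nat R n.+2).[x]
    = x * (legendre_nat R n.+1).[x] + n.+1%:R * E.
  rewrite /legendre_nat /E -/u !hornerZ derivSn du_exp derivnMn derivnXM.
  rewrite !(hornerMn, hornerD, hornerM, hornerX) !factS !exprS !natrM.
  by field; rewrite L1 L2 n1 n2.
have e2 : (legendre_nat R n.+2).[x]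
    = (2 * n.+1 + 1)%:R * E + (legendre_nat R n).[x].
  rewrite /legendre_nat /E -/u !hornerZ 2!derivSn d2u_exp derivnD !derivnMn.
  rewrite !(hornerMn, hornerD, hornerM, hornerX) !factS !exprS !natrM.
  by field; rewrite L1 L2 n1 n2.
have key : (2 * n.+1 + 1)%:R
      * ((legendre_nat R n.+2).[x] - x * (legendre_nat R n.+1).[x])
    = n.+1%:R * ((legendre_nat R n.+2).[x] - (legendre_nat R n).[x]).
  by rewrite [in LHS]e1 [in RHS]e2; ring.
transitivity ((2 * n.+1 + 1)%:R
    * ((legendre_nat R n.+2).[x] - x * (legendre_nat R n.+1).[x])
  + (2 * n.+1 + 1)%:R * x * (legendre_nat R n.+1).[x]
  - n.+1%:R * (legendre_nat R n.+2).[x]); first by ring.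
by rewrite key; ring.
Qed.

Lemma legendre0 x : (legendre_nat R 0).[x] = 1.
Proof. by rewrite /legendre_nat derivn0 !expr0 mul1r invr1 scale1r hornerC. Qed.

Lemma legendre1 x : (legendre_nat R 1).[x] = x.
Proof.
rewrite /legendre_nat derivn1 factS fact0 !expr1 du hornerZ hornerMn hornerX.
by field.
Qed.

End Legendre.

(** * Square roots of quadratics from Legendre-type recurrences *)

Section LegendreSeries.
Variable F : numFieldType.
Variables (b c : F) (g : fps F).

(** In the application b = kappa mu, c = kappa^2 and g_n = kappa^n P_n(mu). *)
Let D : fps F := 1 - fps_const (2 * b) * fpsX F + fps_const c * (fpsX F * fpsX F).

Let eulerD :
  fps_euler D = - fps_const (2 * b) * fpsX F
    + 2 * (fps_const c * (fpsX F * fpsX F)).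
Proof.
have -> : (2 : fps F) = fps_const 2 by rewrite rmorph_nat.
rewrite mulNr; apply/funext => n; rewrite /fps_euler /D !(fpsDE, fpsNE, fpsCM).
by rewrite fpsXM fps1E /fpsX; case: n => [|[|[|n]]] /=; ring.
Qed.

Hypotheses (g0 : g 0%N = 1) (g1 : g 1%N = b).
Hypothesis g_rec : forall n,
  n.+2%:R * g n.+2 = (2 * n.+1 + 1)%:R * b * g n.+1 - n.+1%:R * c * g n.

(** Coefficientwise this is [g_rec], with [g0] and [g1] for the first two coefficients: the
    differential equation solved by D^(-1/2). *)
Let eulerg : 2 * (fps_euler g * D) = - (g * fps_euler D).
Proof.
rewrite eulerD /D; apply/funext => n.
have -> : 2 * (fps_euler g
    * (1 - fps_const (2 * b) * fpsX F + fps_const c * (fpsX F * fpsX F)))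
  = fps_const 2 * (fps_euler g - fps_const (2 * b) * (fpsX F * fps_euler g)
      + fps_const c * (fpsX F * (fpsX F * fps_euler g))).
  by rewrite !rmorphM !rmorph_nat; ring.
have -> : - (g * (- fps_const (2 * b) * fpsX F
      + 2 * (fps_const c * (fpsX F * fpsX F))))
  = fps_const (2 * b) * (fpsX F * g)
    - fps_const (2 * c) * (fpsX F * (fpsX F * g)).
  by rewrite !rmorphM !rmorph_nat; ring.
rewrite !(fpsCM, fpsDE, fpsNE, fpsXM) /fps_euler.
by case: n => [|[|n]]; rewrite ?fpsXM /= ?g_rec ?g0 ?g1; ring.
Qed.

(* [D g^2] has zero [X d/dX]-derivative, so [g] is [D^(-1/2)]. *)
Lemma legendre_series_sqr : g * g * D = 1.
Proof.
have e0 : fps_euler (g * g * D) = 0.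
  rewrite !fps_eulerM.
  transitivity (g * (2 * (fps_euler g * D) + g * fps_euler D)); first by ring.
  by rewrite eulerg; ring.
apply/funext => -[|n].
  by rewrite !fpsM0 g0 /D !(fpsDE, fpsNE, fpsM0) /fpsX /=; ring.
apply/eqP; have /eqP := congr1 (@^~ n.+1) e0.
by rewrite /fps_euler /= mulf_eq0 pnatr_eq0.
Qed.

(** As [g] is D^(-1/2), the series g D is a square root of D. Eliminating b g_(n+1) from its
    coefficients by [g_rec] leaves g_(n+2) - c g_n divided by -(2n+3). *)
Lemma legendre_diff_series_sqr (f : fps F) :
    f 0%N = 1 -> f 1%N = - b ->
    (forall n, (2 * n + 3)%:R * f n.+2 = - (g n.+2 - c * g n)) -> f * f = D.
Proof.
move=> f0 f1 fE; suff -> : f = g * D.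
  by rewrite mulrACA mulrA legendre_series_sqr mul1r.
have -> : g * D = g - fps_const (2 * b) * (fpsX F * g)
      + fps_const c * (fpsX F * (fpsX F * g)) by rewrite /D; ring.
apply/funext => n; rewrite !(fpsCM, fpsDE, fpsNE, fpsXM).
case: n => [|[|n]]; rewrite ?fpsXM /= ?g0 ?g1 ?f0 ?f1; [ring | ring |].
have n0 : (2 * n + 3)%:R != 0 :> F by rewrite pnatr_eq0 addnS.
apply: (mulfI n0); rewrite fE.
have -> : (2 * n + 3)%:R * (g n.+2 - 2 * b * g n.+1 + c * g n)
 = (2 * n + 3)%:R * (g n.+2 + c * g n) - 2 * ((2 * n.+1 + 1)%:R * b * g n.+1).
  by ring.
have -> : (2 * n.+1 + 1)%:R * b * g n.+1 = n.+2%:R * g n.+2 + n.+1%:R * c * g n.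
  by rewrite g_rec; ring.
by ring.
Qed.
End LegendreSeries.

Lemma Rker0 (R : realType) (kappa : R[i]) (mu : R) : Rker kappa mu 0%N = 1.
Proof.
rewrite /Rker /= horner0 legendre0 expr0 subr0.
have -> : (2 * 0%:Z - 1 = -1 :> int)%R by [].
by rewrite rmorphN1 mulr1 invrN1 mul1r opprK.
Qed.

(** The Legendre recurrence times kappa^(n+2) is the required recurrence for kappa^n P_n(mu). The
    equation [fE] retypes the kernel as a series, so that [*] is the Cauchy product. *)
Lemma Rker_series_sqr (R : realType) (kappa : R[i]) (mu : R) (f : fps R[i]) :
  f = Rker kappa mu ->
  f * f = 1 - fps_const (2 * (kappa * mu%:C)) * fpsX _
          + fps_const (kappa ^+ 2) * (fpsX _ * fpsX _).
Proof.
move=> fE.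
pose g : fps R[i] := fun n => kappa ^+ n * ((legendre_nat R n).[mu])%:C.
apply: (@legendre_diff_series_sqr _ _ _ g).
- by rewrite /g legendre0 mulr1.
- by rewrite /g legendre1 expr1.
- move=> n; have /(congr1 (fun x => kappa ^+ n.+2 * x%:C)) := legendre_rec mu n.
  rewrite /g !(rmorphM, rmorphB, rmorph_nat) /= => e.
  rewrite mulrCA e !exprS expr0; ring.
- by rewrite fE Rker0.
- rewrite fE /Rker /= horner0 legendre1 expr1 subr0.
  have -> : (2 * 1%:Z - 1 = 1 :> int)%R by [].
  by rewrite divr1 mulNr.
- move=> n; rewrite fE /Rker.
  have -> : (n.+2%:Z - 2)%R = n%:Z by rewrite -addn2 PoszD addrK.
  have -> : (2 * n.+2%:Z - 1)%R = (2 * n + 3)%N%:Z by lia.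
  have n0 : (2 * n + 3)%:R != 0 :> R[i] by rewrite pnatr_eq0 addnS.
  rewrite /= /g -pmulrn rmorphB /= !exprS expr0 mulr1.
  by field.
Qed.

(** * Arguments and moduli of complex numbers *)

Section ComplexNorm.
Variable R : realType.
Implicit Types z w : R[i].

Lemma normc_ge0 z : 0 <= normc z.
Proof. by case: z => x y; apply: sqrtr_ge0. Qed.

Lemma normc_sqr z : normc z ^+ 2 = complex.Re z ^+ 2 + complex.Im z ^+ 2.
Proof. by case: z => x y; rewrite /= sqr_sqrtr // addr_ge0 ?sqr_ge0. Qed.

Lemma normc_gt0 z : (0 < normc z) = (z != 0).
Proof.
rewrite lt_def normc_ge0 andbT; congr (~~ _).
by apply/eqP/eqP => [/eq0_normc //|->]; rewrite normc0.
Qed.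

Lemma norm_normc z : `|z| = (normc z)%:C.
Proof. by []. Qed.

Lemma normcD_le z w : normc (z + w) <= normc z + normc w.
Proof. by rewrite -lecR rmorphD /= -!norm_normc ler_normD. Qed.

Lemma normc_sum_le n (f : 'I_n -> R[i]) :
  normc (\sum_(i < n) f i) <= \sum_(i < n) normc (f i).
Proof.
elim/big_ind2: _ => [|x1 x2 y1 y2 h1 h2|//]; first by rewrite normc0.
exact: le_trans (normcD_le _ _) (lerD h1 h2).
Qed.

Lemma normcN z : normc (- z) = normc z.
Proof. by case: z => x y; rewrite /= !sqrrN. Qed.

Lemma ltr_normc z w : (normc z < normc w) = (normc z ^+ 2 < normc w ^+ 2).
Proof. by rewrite ltr_pXn2r ?nnegrE ?normc_ge0. Qed.

Lemma expiD (x y : R) : expi (x + y) = expi x * expi y.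
Proof. by rewrite /expi cosD sinD; simpc; congr (_ +i* _); ring. Qed.

Lemma expiN (x : R) : expi (- x) = (expi x)^*.
Proof. by rewrite /expi cosN sinN. Qed.

Lemma expiNM (x : R) : expi (- x) * expi x = 1.
Proof. by rewrite -expiD addNr /expi cos0 sin0. Qed.

Lemma arg_exists z : z != 0 -> exists2 phi, arg z phi & 0 <= phi < 2 * pi.
Proof.
case: z => x y z0; have r0 : 0 < normc (x +i* y) by rewrite normc_gt0.
have /= rE := normc_sqr (x +i* y).
have zr phi : x +i* y = (normc (x +i* y))%:C * expi phi -> arg (x +i* y) phi by [].
move: r0 rE zr; rewrite -[Num.sqrt _]/(normc (x +i* y)).
move: (normc _) => r r0 rE zr.
pose c := x / r; have xE : x = r * c by rewrite /c mulrC divfK ?gt_eqF.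
pose s := y / r; have yE : y = r * s by rewrite /s mulrC divfK ?gt_eqF.
have cs : c ^+ 2 + s ^+ 2 = 1.
  apply: (@mulfI _ (r ^+ 2)); first by rewrite expf_neq0 ?gt_eqF.
  by rewrite mulr1 [RHS]rE xE yE; ring.
have c1 : -1 <= c <= 1 by apply/andP; split; nra.
have cK : cos (acos c) = c by rewrite acosK // in_itv.
have sK : sin (acos c) = `|s|.
  by rewrite sin_acos // -sqrtr_sqr -cs addrAC subrr add0r.
have zE phi : cos phi = c -> sin phi = s -> arg (x +i* y) phi.
  by move=> cE sE; apply: zr; rewrite /expi cE sE xE yE; simpc.
have pi0 := pi_gt0 R; have ac0 := acos_ge0 c1; have acpi := acos_lepi c1.
have [s0|s0] := leP 0 s.
  by exists (acos c); [apply: zE; rewrite ?sK ?ger0_norm | lra].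
exists (2 * pi - acos c); last first.
  (* In the lower half-plane s < 0 forces c < 1, which keeps the angle 2 pi - acos c strictly below
     2 pi. *)
  have : 0 < acos c by apply: acos_gt0; nra.
  by move: acpi; lra.
have e : 2 * pi = pi *+ 2 :> R by rewrite mulr_natl.
apply: zE; rewrite e addrC.
  by rewrite cosD2pi cosN.
by rewrite sinD2pi sinN sK ltr0_norm ?opprK.
Qed.

Lemma arg0P z : z != 0 -> arg z (arg0 z) /\ 0 <= arg0 z < 2 * pi.
Proof.
move=> z0; rewrite /arg0; case: xgetP => [phi _ [] //|h].
by have [phi h1 h2] := arg_exists z0; case: (h phi).
Qed.

(* The half-argument of [z] off the positive real axis lies in (0, pi). *)
Lemma sqrt_conj_arg0 z :
    z != 0 -> (complex.Im z = 0 -> complex.Re z < 0) ->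
  let c := - (Num.sqrt (normc z) / 2)%:C * expi (- (arg0 z / 2)) in
  4 * c ^+ 2 = z^* /\ 0 < complex.Im c.
Proof.
move=> z0 zneg c; have [zE /andP[ge0 lt2pi]] := arg0P z0; split.
  have e1 : expi (- (arg0 z / 2)) ^+ 2 = expi (- arg0 z).
    by rewrite expr2 -expiD -opprD -splitr.
  have e2 : 4 * ((Num.sqrt (normc z) / 2)%:C) ^+ 2 = (normc z)%:C.
    rewrite -[4](rmorph_nat (real_complex R)) -rmorphXn -rmorphM; congr _%:C.
    by rewrite exprMn sqr_sqrtr ?normc_ge0 //; field.
  by rewrite /c exprMn sqrrN e1 mulrA e2 expiN [in RHS]zE [RHS]rmorphM /= oppr0.
rewrite /c /expi cosN sinN; simpc => /=.
rewrite mulr_gt0 //.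
  by rewrite divr_gt0 // sqrtr_gt0 normc_gt0.
apply: sin_gt0_pi; rewrite ltr_pdivrMr // [pi * 2]mulrC lt2pi andbT divr_gt0 //.
rewrite lt_def ge0 andbT; apply/eqP => e0.
move: zE; rewrite /arg /= e0 /expi cos0 sin0 => zE.
have : complex.Re z < 0 by apply: zneg; rewrite zE; simpc.
by rewrite zE; simpc; rewrite /= ltNge normc_ge0.
Qed.

(* With [u = p / e], the identity [2 Re u Im e = Im p + |u|^2 Im q] gives the
   sign of [Re u], hence of [Re (p e^* )] and [Re (q e^* )]. *)
Lemma Re_mul_conj_sqrt (p q e : R[i]) : e ^+ 2 = p * q -> q != 0 ->
    complex.Im p < 0 -> complex.Im q <= 0 -> 0 < complex.Im e ->
  complex.Re (p * e^*) < 0 /\ complex.Re (q * e^*) < 0.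
Proof.
case: p q e => [p1 p2] [q1 q2] [e1 e2]; rewrite expr2; simpc.
case=> h1 h2 /eqP q0 /= p2n q2n e2p.
have n1 : 0 < q1 ^+ 2 + q2 ^+ 2.
  rewrite lt_def addr_ge0 ?sqr_ge0 // andbT; apply/eqP => /eqP.
  rewrite paddr_eq0 ?sqr_ge0 // !sqrf_eq0 => /andP[/eqP z1 /eqP z2].
  by apply: q0; rewrite z1 z2.
have k1 : 2 * (p1 * e1 + p2 * e2) * e2 =
    p2 * (e1 ^+ 2 + e2 ^+ 2) + q2 * (p1 ^+ 2 + p2 ^+ 2).
  (* This is Im (e^2 conj p) = |p|^2 Im q. *)
  have : (e1 * e2 + e2 * e1) * p1 - (e1 * e1 - e2 * e2) * p2 =
    (p1 * q2 + p2 * q1) * p1 - (p1 * q1 - p2 * q2) * p2 by rewrite h1 h2.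
  by nra.
have k2 : 2 * (q1 * e1 + q2 * e2) * e2 =
    q2 * (e1 ^+ 2 + e2 ^+ 2) + p2 * (q1 ^+ 2 + q2 ^+ 2).
  have : (e1 * e2 + e2 * e1) * q1 - (e1 * e1 - e2 * e2) * q2 =
    (p1 * q2 + p2 * q1) * q1 - (p1 * q1 - p2 * q2) * q2 by rewrite h1 h2.
  by nra.
have e20 : 0 < e1 ^+ 2 + e2 ^+ 2 by rewrite ltr_wpDl ?sqr_ge0 // exprn_gt0.
have pos x : 2 * x * e2 < 0 -> x < 0 by rewrite pmulr_llt0 // pmulr_rlt0.
split; apply: pos; rewrite ?k1 ?k2.
  by rewrite ltr_wnDr ?nmulr_rlt0 // mulr_le0_ge0 // addr_ge0 ?sqr_ge0.
by rewrite ltr_wnDl ?nmulr_rlt0 // mulr_le0_ge0 // ltW.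
Qed.

Lemma normcD_ltB (z w : R[i]) :
  complex.Re (z * w^*) < 0 -> normc (z + w) < normc (z - w).
Proof.
rewrite ltr_normc !normc_sqr; case: z w => [x y] [x' y']; simpc => /=.
nra.
Qed.

End ComplexNorm.

(** * Recurrences with power series coefficients *)

(** Time averages and differences couple two consecutive levels only, so the scheme has coefficients
    affine in z. *)
Definition fps_affine (F : comNzRingType) (c0 c1 : F) : fps F :=
  fps_const c0 + fps_const c1 * fpsX F.

Lemma fps_affineM (F : comNzRingType) (c0 c1 : F) f n :
  (fps_affine c0 c1 * f) n = c0 * f n + c1 * (if n is k.+1 then f k else 0).
Proof. by rewrite /fps_affine mulrDl -mulrA fpsDE !fpsCM fpsXM. Qed.

Lemma fps_affine0 (F : comNzRingType) (c0 c1 : F) : fps_affine c0 c1 0%N = c0.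
Proof. by rewrite /fps_affine fpsDE fpsCM /fpsX mulr0 addr0. Qed.

Lemma fps_affine_inv (F : fieldType) (c0 c1 : F) :
  c0 != 0 -> exists g : fps F, fps_affine c0 c1 * g = 1.
Proof.
move=> c00; exists (fun n => c0^-1 * (- c1 / c0) ^+ n).
apply/funext => n; rewrite fps_affineM fps1E; case: n => [|n] /=.
  by rewrite expr0 mulr1 mulr0 addr0 divff.
by rewrite exprS; field.
Qed.

(** Lets an induction on time levels replace a series by its constant term. *)
Lemma fpsM_head (F : comNzRingType) (f g : fps F) m :
  (forall l, (l < m)%N -> g l = 0) -> (f * g) m = f 0%N * g m.
Proof.
move=> gm; rewrite fpsME big_ord_recl subn0 big1 ?addr0 // => i _.
rewrite gm ?mulr0 //= /bump /= add1n ltn_subrL /=.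
exact: leq_ltn_trans (ltn_ord i).
Qed.

Section Recurrence.
Variable R : realType.
Implicit Types (f g : fps R[i]) (y : nat -> fps R[i]).

(** Uniform in the space index, separately at each time level: what square summability provides. *)
Definition coef_bounded y :=
  forall m, exists B : R, forall k, normc (y k m) <= B.

Lemma coef_boundedM f y : coef_bounded y -> coef_bounded (fun k => f * y k).
Proof.
move=> yB m; have /choice[B hB] := yB.
exists (\sum_(i < m.+1) normc (f i) * B (m - i)%N) => k.
rewrite fpsME; apply: le_trans (normc_sum_le _) _; apply: ler_sum => i _.
by rewrite normcM ler_wpM2l ?normc_ge0.
Qed.

Lemma coef_boundedB y y' : coef_bounded y -> coef_bounded y' ->
  coef_bounded (fun k => y k - y' k).
Proof.
move=> yB yB' m; have [B hB] := yB m; have [B' hB'] := yB' m.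
exists (B + B') => k; rewrite fpsDE fpsNE.
by apply: le_trans (normcD_le _ _) _; rewrite normcN lerD.
Qed.

(** With r = |p| / |q| < 1, one has |w_k| <= r^n |w_(n+k)| <= r^n B for every n. The undivided
    relation also covers p = 0. *)
Lemma bounded_geometric_eq0 (w : nat -> R[i]) (p q : R[i]) (B : R) :
    normc p < normc q -> (forall k, p * w k.+1 = q * w k) ->
  (forall k, normc (w k) <= B) -> forall k, w k = 0.
Proof.
move=> pq wE wB k; apply: eq0_normc; apply/eqP; rewrite eq_le normc_ge0 andbT.
have q0 : 0 < normc q := le_lt_trans (normc_ge0 p) pq.
pose r := normc p / normc q.
have r0 : 0 <= r by rewrite divr_ge0 ?normc_ge0.
have r1 : r < 1 by rewrite ltr_pdivrMr // mul1r.
have wr n : normc (w k) <= r ^+ n * B.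
  apply: le_trans (_ : r ^+ n * normc (w (n + k)%N) <= _); last first.
    by rewrite ler_wpM2l ?exprn_ge0.
  elim: n => [|n IHn]; first by rewrite expr0 mul1r.
  apply: le_trans IHn _; rewrite exprSr -mulrA ler_wpM2l ?exprn_ge0 //.
  rewrite /r mulrAC -normcM addSn wE normcM mulrAC divff ?gt_eqF // mul1r.
  exact: lexx.
have r_cvg : geometric B r @ \oo --> 0.
  by apply: cvg_geometric; rewrite ger0_norm.
rewrite -(cvg_lim (@Rhausdorff R) r_cvg); apply: limr_ge; first exact: cvgP r_cvg.
by apply: nearW => n; rewrite /geometric /= mulrC.
Qed.

Variables p0 p1 : R[i].
Variables M N : fps R[i].
Let P := fps_affine p0 p1.
Hypotheses (p00 : p0 != 0) (MN : M * N = P * P) (PN : normc p0 < normc (N 0%N)).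

(* The residual [N y_{k+1} - P y_k] is carried by the growing mode, so it
   vanishes for bounded [y]. *)
Lemma bounded_recurrence y :
    (forall k, P * (y k.+2 + y k) = (M + N) * y k.+1) -> coef_bounded y ->
  forall k, N * y k.+1 = P * y k.
Proof.
move=> yE yB; pose w k := N * y k.+1 - P * y k.
have wB : coef_bounded w.
  apply: coef_boundedB; apply: coef_boundedM => // m.
  by have [B hB] := yB m; exists B.
(* M N = P^2 factors the second-order recurrence into two of first order; [w] obeys the one with the
   growing root. *)
have wE k : P * w k.+1 = N * w k.
  rewrite /w mulrBr !mulrA -MN.
  have -> : P * N * y k.+2 = N * (P * (y k.+2 + y k)) - N * P * y k by ring.
  by rewrite yE; ring.
suff w0 m k : w k m = 0.
  move=> k; apply/eqP; rewrite -subr_eq0; apply/eqP.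
  by apply/funext => m; apply: w0.
(* Once the lower levels vanish, level m sees only constant terms: p0 w_(k+1) = N(0) w_k. *)
elim/ltn_ind: m k => m IHm; have [B hB] := wB m.
apply: (bounded_geometric_eq0 PN _ hB) => k.
rewrite -(fps_affine0 p0 p1) -/P -fpsM_head => [|l /IHm //].
by rewrite wE fpsM_head // => l /IHm.
Qed.

(** A constant with q B + c <= r B closes the induction; it exists because q < r. *)
Lemma geometric_bound (x : nat -> R) (q r c : R) :
    0 <= q < r -> 0 <= c -> (forall k, x k.+1 <= q * x k + c * r ^+ k) ->
  exists B : R, forall k, x k <= B * r ^+ k.
Proof.
move=> /andP[q0 qr] c0 xS; have rq : 0 < r - q by rewrite subr_gt0.
have r0 : 0 <= r := le_trans q0 (ltW qr).
pose B := `|x 0%N| + c / (r - q); exists B.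
have cB : c <= B * (r - q) by rewrite -ler_pdivrMr // lerDr.
elim=> [|k IHk].
  by rewrite expr0 mulr1 (le_trans (ler_norm _)) // lerDl divr_ge0 // ltW.
apply: le_trans (xS k) _; apply: le_trans (_ : (q * B + c) * r ^+ k <= _).
  by rewrite mulrDl lerD2r -mulrA ler_wpM2l.
by rewrite exprS mulrA ler_wpM2r ?exprn_ge0 //; move: cB; rewrite mulrBr; lra.
Qed.

(** Coefficient m of S^(k+1) Phi is S(0) times that of S^k Phi plus a combination of lower ones,
    geometric by induction on m. The margin r > |S(0)| absorbs the polynomial growth in k. *)
Lemma fps_pow_coef_bound (S Phi : fps R[i]) (r : R) m : normc (S 0%N) < r ->
  exists B : R, forall k, normc ((S ^+ k * Phi) m) <= B * r ^+ k.
Proof.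
move=> Sr; have r0 : 0 <= r := le_trans (normc_ge0 _) (ltW Sr).
elim/ltn_ind: m => m IHm.
have /choice[B hB] : forall l, exists B : R, forall k, (l < m)%N ->
    normc ((S ^+ k * Phi) l) <= B * r ^+ k.
  move=> l; have [/IHm[B hB]|_] := ltnP l m; last by exists 0.
  by exists B => k _.
pose c := \sum_(i < m) normc (S i.+1) * `|B (m - i.+1)%N|.
apply: (@geometric_bound _ (normc (S 0%N)) _ c).
- by rewrite normc_ge0.
- by apply: sumr_ge0 => i _; rewrite mulr_ge0 ?normc_ge0.
move=> k; rewrite exprS -mulrA fpsME big_ord_recl subn0.
apply: le_trans (normcD_le _ _) _; rewrite normcM lerD2l.
apply: le_trans (normc_sum_le _) _; rewrite /c mulr_suml; apply: ler_sum => i _.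
rewrite normcM -mulrA ler_wpM2l ?normc_ge0 //.
apply: le_trans (hB _ _ _) _.
  by rewrite ltn_subrL /= (leq_ltn_trans _ (ltn_ord i)).
by rewrite ler_wpM2r ?exprn_ge0 // ler_norm.
Qed.

(** The decaying mode is y_k = S^(k-1) Phi with S = M / P, and S N = P gives |S(0)| = |p0| / |N(0)|
    < 1. *)
Lemma decaying_recurrence (Phi : fps R[i]) : Phi 0%N = 0 ->
  exists y : nat -> fps R[i],
    [/\ y 1%N = Phi, forall k, y k 0%N = 0,
        forall k, P * (y k.+2 + y k) = (M + N) * y k.+1
      & exists2 r : R, 0 <= r < 1 & forall m,
          exists B : R, forall k, normc (y k.+1 m) <= B * r ^+ k].
Proof.
move=> Phi0; have [G PG] := fps_affine_inv p1 p00; rewrite -/P in PG.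
pose S := M * G.
have S1 : normc (S 0%N) < 1.
  have SN : S 0%N * N 0%N = p0.
    have : S * N = P by rewrite -[RHS]mulr1 -PG [RHS]mulrA -MN /S; ring.
    by move/(congr1 (@^~ 0%N)); rewrite fpsM0 /P fps_affine0.
  have N0 : 0 < normc (N 0%N) := le_lt_trans (normc_ge0 _) PN.
  by rewrite -(ltr_pM2r N0) -normcM SN mul1r.
(* As (M / P)(N / P) = 1, the value N G Phi at k = 0 is S^(-1) Phi. *)
exists (fun k => if k is k'.+1 then S ^+ k' * Phi else N * G * Phi); split.
- by rewrite expr0 mul1r.
- by case=> [|k]; rewrite fpsM0 Phi0 mulr0.
- case=> [|k].
    have -> : P * (S ^+ 1 * Phi + N * G * Phi) = P * G * (M + N) * Phi.
      by rewrite /S expr1; ring.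
    by rewrite PG mul1r expr0 mul1r.
  rewrite -mulrDl !mulrA; congr (_ * Phi); rewrite !exprS.
  have -> : P * (S * (S * S ^+ k) + S ^+ k) = S ^+ k * (M * (P * G) * S + P).
    by rewrite /S; ring.
  have PE : P = M * N * G by rewrite MN -mulrA PG mulr1.
  by rewrite PG mulr1 PE; move: (S ^+ k) => Sk; rewrite /S; ring.
have [r /andP[Sr r1]] : exists r, normc (S 0%N) < r < 1.
  by exists ((normc (S 0%N) + 1) / 2); rewrite midf_lt // midf_lt.
exists r => [|m]; last exact: fps_pow_coef_bound.
by rewrite r1 andbT (le_trans (normc_ge0 _) (ltW Sr)).
Qed.

End Recurrence.

(** * The scheme on the half-axis *)

Lemma fps_affine_mul (F : comNzRingType) (c0 c1 d0 d1 : F) :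
  fps_affine c0 c1 * fps_affine d0 d1
  = fps_const (c0 * d0) + fps_const (c0 * d1 + c1 * d0) * fpsX F
    + fps_const (c1 * d1) * (fpsX F * fpsX F).
Proof. by rewrite /fps_affine !(rmorphD, rmorphM) /=; ring. Qed.

Lemma fps_affineD (F : comNzRingType) (c0 c1 d0 d1 : F) :
  fps_affine c0 c1 + fps_affine d0 d1 = fps_affine (c0 + d0) (c1 + d1).
Proof. by rewrite /fps_affine !rmorphD /=; ring. Qed.

(** * Square summability: geometric decay suffices, boundedness follows *)

Section SquareSum.
Variable R : realType.
Implicit Types (u : nat -> R) (f : nat -> R[i]).

Lemma nneseries_geometric_lty u (c r : R) : 0 <= r < 1 ->
    (forall k, 0 <= u k <= c * r ^+ k) ->
  (\sum_(0 <= k <oo) (u k)%:E < +oo)%E.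
Proof.
move=> /andP[r0 r1] uP; have r1' : 0 < 1 - r by rewrite subr_gt0.
apply: le_lt_trans (ltry (c / (1 - r))); apply: lime_le.
  by apply: is_cvg_nneseries => k _ _; rewrite lee_fin; have /andP[] := uP k.
apply: nearW => n; rewrite sumEFin lee_fin.
apply: (@le_trans _ _ (c / (1 - r) * (1 - r ^+ n))); last first.
  have c0 : 0 <= c by have /andP[/le_trans le /le] := uP 0%N; rewrite mulr1.
  by rewrite ler_piMr ?gerBl ?exprn_ge0 // divr_ge0 // ltW.
elim: n => [|n IHn]; first by rewrite big_geq // expr0 subrr mulr0.
rewrite big_nat_recr //=; have /andP[_ un] := uP n.
apply: le_trans (lerD IHn un) _; rewrite exprS.
by rewrite le_eqVlt; apply/orP; left; apply/eqP; field; rewrite gt_eqF.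
Qed.

Lemma sqr_summable_bounded f J :
    (\sum_(J <= j <oo) (normc (f j) ^+ 2)%:E < +oo)%E ->
  exists B : R, forall j, (J <= j)%N -> normc (f j) <= B.
Proof.
set S := (\sum_(_ <= _ <oo) _)%E => S_lty.
have nn j : (0%E <= (normc (f j) ^+ 2)%:E)%E by rewrite lee_fin sqr_ge0.
have S0 : (0%E <= S)%E by apply: nneseries_ge0.
(* The bound t <= t^2 + 1 avoids a square root of the sum. *)
exists (fine S + 1) => j Jj.
have : ((normc (f j) ^+ 2)%:E <= S)%E.
  apply: (le_trans _ (nneseries_lim_ge j.+1 (fun n _ _ => nn n))).
  by rewrite big_nat_recr //= leeDr // sume_ge0.
rewrite -(fineK (_ : S \is a fin_num)) ?ge0_fin_numE // lee_fin => fS.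
have := sqr_ge0 (normc (f j) - 1); have := normc_ge0 (f j).
by move: fS; nra.
Qed.

End SquareSum.

(** * The scheme and its boundary operator in generating functions *)

Section Scheme.
Variables (R : realType) (theta h tau hbar rho B V : R).
Hypotheses (htheta : theta <= 1 / 4) (hh : 0 < h) (htau : 0 < tau).
Hypotheses (hhbar : 0 < hbar) (hrho : 0 < rho) (hB : 0 < B).

Let a0 : R := V / (hbar ^+ 2 * B).
Let a1 : R := 2 * rho / (tau * hbar * B).
Let a : R[i] := a0 +i* a1.

(** The operator i hbar rho [dtbar] - V [stbar] is multiplication by -(hbar^2 B / 2)(conj a + a z):
    [ac] goes with the current level, [a] with the previous one. *)
Let ac : R[i] := a0 -i* a1.

Let P := fps_affine (1 - 2 * (h ^+ 2 * theta)%:C * ac)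
                    (1 - 2 * (h ^+ 2 * theta)%:C * a).
Let Q := fps_affine ((h ^+ 2)%:C * ac) ((h ^+ 2)%:C * a).

Let nz (x : R) : 0 < x -> x%:C != 0.
Proof. by move=> x0; rewrite fmorph_eq0 gt_eqF. Qed.

Let aE : a = V%:C / (hbar%:C ^+ 2 * B%:C)
  + 'i * (2 * rho%:C / (tau%:C * hbar%:C * B%:C)).
Proof.
rewrite [LHS]complexE /= /a0 /a1.
by rewrite !(rmorphM, fmorphV, rmorphXn, rmorph_nat).
Qed.

Let acE : ac = V%:C / (hbar%:C ^+ 2 * B%:C)
  - 'i * (2 * rho%:C / (tau%:C * hbar%:C * B%:C)).
Proof.
rewrite [LHS]complexE /= /a0 /a1.
by rewrite !(rmorphM, fmorphV, rmorphXn, rmorph_nat, rmorphN) /= mulrN.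
Qed.

Lemma scheme_seriesE (Psi : nat -> fps R[i]) j m :
  scheme theta h tau hbar rho B V Psi j m.+1 <->
  (P * (Psi j.+1 + Psi j.-1)) m.+1 = (2 * (P + Q) * Psi j) m.+1.
Proof.
rewrite /scheme /Ctheta /dtbar /stbar /=.
have -> : 2 * (P + Q) * Psi j = fps_const 2 * ((P + Q) * Psi j).
  by rewrite rmorph_nat mulrA.
rewrite fpsCM /P /Q fps_affineD !fps_affineM !fpsDE acE aE.
rewrite !(rmorphM, fmorphV, rmorphXn, rmorph_nat, rmorphB, rmorph1) /=.
have := nz hh; have := nz htau; have := nz hhbar; have := nz hB.
have i2 : (2 : R[i]) != 0 by rewrite pnatr_eq0.
move: (h%:C) (tau%:C) (hbar%:C) (rho%:C) (B%:C) (V%:C) (theta%:C).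
move=> x1 x2 x3 x4 x5 x6 x7.
move: (Psi j m) (Psi j m.+1) (Psi j.-1 m) (Psi j.-1 m.+1).
move: (Psi j.+1 m) (Psi j.+1 m.+1).
move=> y1 y2 y3 y4 y5 y6 n4 n3 n2 n1.
have key (c u v u' v' : R[i]) : c != 0 -> u - v = c * (u' - v') ->
    u = v <-> u' = v'.
  move=> c0 e; split=> /eqP; rewrite -subr_eq0 => /eqP d; apply/eqP;
      rewrite -subr_eq0.
    by move: e => /eqP; rewrite d eq_sym mulf_eq0 (negPf c0).
  by rewrite e d mulr0.
(* The scheme is the series identity multiplied by hbar^2 B / (4 h^2). *)
apply: (key (x3 ^+ 2 * x5 / (4 * x1 ^+ 2))).
  by rewrite !(mulf_neq0, invr_neq0, expf_neq0) // pnatr_eq0.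
by field; rewrite n1 n2 n3 n4.
Qed.
Lemma dtbc_lhs_seriesE (Psi : nat -> fps R[i]) j m :
  dtbc_lhs theta h tau hbar rho B V j Psi m.+1
  = (hbar ^+ 2 / 2 * B)%:C
    * ((2 * h%:C)^-1 * (P * (Psi j - Psi j.-1) + Q * Psi j) m.+1).
Proof.
rewrite /dtbc_lhs /sxminus /dtbar /stbar /=.
rewrite !fpsDE /P /Q !fps_affineM !fpsDE !fpsNE acE aE.
rewrite !(rmorphM, fmorphV, rmorphXn, rmorph_nat, rmorphB, rmorph1) /=.
have := nz hh; have := nz htau; have := nz hhbar; have := nz hB.
move: (h%:C) (tau%:C) (hbar%:C) (rho%:C) (B%:C) (V%:C) (theta%:C).
move=> x1 x2 x3 x4 x5 x6 x7.
move: (Psi j m) (Psi j m.+1) (Psi j.-1 m) (Psi j.-1 m.+1).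
by move=> y1 y2 y3 y4 n4 n3 n2 n1; field; rewrite n1 n2 n3 n4.
Qed.

Let s := (1 - 4 * theta) * h ^+ 2.
Let alpha : R[i] := 2 * a + s%:C * a ^+ 2.
Let beta : R := 2 * a0 + s * normc a ^+ 2.

Let a1_gt0 : 0 < a1.
Proof. by rewrite divr_gt0 // !mulr_gt0. Qed.

Let s_ge0 : 0 <= s.
Proof. by rewrite mulr_ge0 ?sqr_ge0 //; move: htheta; lra. Qed.

Let alphaE :
  alpha = (2 * a0 + s * (a0 ^+ 2 - a1 ^+ 2)) +i* (2 * a1 * (1 + s * a0)).
Proof.
rewrite /alpha /a expr2 -[2](rmorph_nat (real_complex R)); simpc.
by congr (_ +i* _); ring.
Qed.

(** Here 2 P + Q = (2 + s conj a) + (2 + s a) z, so this and [betaE] give the coefficients conj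
    alpha and 2 beta of Q (2 P + Q) / h^2. *)
Let conj_alphaE : alpha^* = ac * (2 + s%:C * ac).
Proof.
rewrite alphaE /ac -[2 in RHS](rmorph_nat (real_complex R)); simpc.
by congr (_ +i* _); ring.
Qed.

Let betaE : beta%:C = ac + a + s%:C * (ac * a).
Proof.
rewrite /beta normc_sqr /a /ac; simpc.
by congr (_ +i* _); rewrite /=; ring.
Qed.

(** The number conj a (2 + s a) has modulus |alpha|, real part beta and imaginary part -2 a1. As a1
    > 0, both alpha != 0 and |mu| < 1 follow. *)
Lemma sqr_normc_alpha : normc alpha ^+ 2 = beta ^+ 2 + 4 * a1 ^+ 2.
Proof. by rewrite normc_sqr alphaE /beta normc_sqr /=; ring. Qed.

Lemma alpha_neq0 : alpha != 0.
Proof.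
rewrite -normc_gt0 -(@ltr_pXn2r _ 2) ?nnegrE ?normc_ge0 // expr0n sqr_normc_alpha.
by rewrite ltr_wpDl ?sqr_ge0 // mulr_gt0 // exprn_gt0.
Qed.

Lemma mu_bounds : -1 < beta / normc alpha < 1.
Proof.
have n0 : 0 < normc alpha by rewrite normc_gt0 alpha_neq0.
rewrite -ltr_norml normrM normfV (gtr0_norm n0) ltr_pdivrMr // mul1r.
rewrite -(@ltr_pXn2r _ 2) ?nnegrE ?normr_ge0 ?normc_ge0 //.
by rewrite real_normK ?num_real // sqr_normc_alpha ltrDl mulr_gt0 // exprn_gt0.
Qed.

(** Im alpha = 0 forces s a0 = -1, hence a0 < 0 and Re alpha = a0 - s a1^2 < 0. The bound theta <=
    1/4 enters through s >= 0. *)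
Let Re_alpha_lt0 : complex.Im alpha = 0 -> complex.Re alpha < 0.
Proof.
have a1_2 : (2 * a1 == 0) = false by rewrite gt_eqF // pmulr_rgt0.
rewrite alphaE /= => /eqP; rewrite mulf_eq0 a1_2 /= => /eqP sa0.
have a0_lt0 : a0 < 0.
  by rewrite ltNge; apply/negP => a0_ge0; have := mulr_ge0 s_ge0 a0_ge0; lra.
have := mulr_ge0 s_ge0 (sqr_ge0 a1).
have -> : 2 * a0 + s * (a0 ^+ 2 - a1 ^+ 2)
  = a0 + a0 * (1 + s * a0) - s * a1 ^+ 2 by ring.
by rewrite sa0; lra.
Qed.

Let c0 : R[i] := - (Num.sqrt (normc alpha) / 2)%:C * expi (- (arg0 alpha / 2)).

Let sqr_c0 : 4 * c0 ^+ 2 = ac * (2 + s%:C * ac).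
Proof. by have [-> _] := sqrt_conj_arg0 alpha_neq0 Re_alpha_lt0. Qed.

Let Im_c0 : 0 < complex.Im c0.
Proof. by have [_ ->] := sqrt_conj_arg0 alpha_neq0 Re_alpha_lt0. Qed.

Let p0 := 1 - 2 * (h ^+ 2 * theta)%:C * ac.
Let q0 := (h ^+ 2)%:C * ac.

Let p0_neq0 : p0 != 0.
Proof.
have -> : p0 = (1 - 2 * (h ^+ 2 * theta) * a0) +i* (2 * (h ^+ 2 * theta) * a1).
  by rewrite /p0 /ac -[2](rmorph_nat (real_complex R)); simpc.
apply/eqP => -[e1 /eqP]; rewrite mulf_eq0 (gt_eqF a1_gt0) orbF => /eqP e2.
by move: e1; rewrite e2 mul0r subr0 => /eqP; rewrite oner_eq0.
Qed.

(* The sign of [c0], i.e. the choice of [arg_0], enters only here. *)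
Let decaying_root :
  normc (p0 + q0 + 2 * h%:C * c0) < normc (p0 + q0 - 2 * h%:C * c0).
Proof.
apply: normcD_ltB.
have qn0 : 2 + s%:C * ac != 0.
  apply: contraNneq alpha_neq0 => e; rewrite -(inj_eq (can_inj (@conjcK _))).
  by rewrite conj_alphaE e mulr0 rmorph0.
(* Taken at e = 2 c0, since 4 c0^2 = conj alpha is the product of the two factors. *)
have [] := @Re_mul_conj_sqrt R ac (2 + s%:C * ac) (2 * c0) _ qn0.
- by rewrite exprMn -sqr_c0 -natrX.
- by rewrite /ac /= oppr_lt0.
- rewrite /ac -[2](rmorph_nat (real_complex R)); simpc => /=.
  by rewrite oppr_le0 mulr_ge0 // ltW.
- move: Im_c0; case: c0 => x y; rewrite mulr_natl mulr2n /= => y0.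
  by rewrite addr_gt0.
(* Positive weights on the two factors, so the two negative real parts add up. *)
have -> : p0 + q0 = (2^-1)%:C * (2 + s%:C * ac) + (h ^+ 2 / 2)%:C * ac.
  rewrite /p0 /q0 /s.
  rewrite !(rmorphM, fmorphV, rmorphXn, rmorph_nat, rmorphB, rmorph1) /=.
  by field.
move: (2 + _) c0 => [q1 q2] [e1 e2].
rewrite /ac -[2](rmorph_nat (real_complex R)).
simpc => /= h1 h2.
rewrite (_ : _ + _ = h / 2 * (q1 * (2 * e1) + q2 * (2 * e2)) +
  h ^+ 3 / 2 * (a0 * (2 * e1) - a1 * (2 * e2))); last by field.
by rewrite -[ltRHS]addr0 ltrD // pmulr_rlt0 // divr_gt0 // exprn_gt0.
Qed.

(** * The convolution kernel as a square root, and the operator [Sref] *)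

Section Kernel.
Variable phi : R.
Hypothesis phiP : arg alpha phi.

Let K : fps R[i] :=
  fps_const c0 * (Rker (- expi phi) (beta / normc alpha) : fps R[i]).
Let M := P + Q + fps_const (2 * h%:C) * K.
Let N := P + Q - fps_const (2 * h%:C) * K.

(** Since conj alpha = |alpha| e^(-i phi), one has conj alpha kappa^2 = alpha and conj alpha kappa
    mu = -beta, whichever value phi of the argument is taken. *)
Lemma kernel_sqr : fps_const (4 * h%:C ^+ 2) * (K * K) = Q * (2 * P + Q).
Proof.
have r0 : (normc alpha)%:C != 0 by rewrite nz // normc_gt0 alpha_neq0.
have e_alpha : alpha = (normc alpha)%:C * expi phi by [].
have e_conj : conjc alpha = (normc alpha)%:C * expi (- phi).
  by rewrite {1}e_alpha expiN rmorphM /= oppr0.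
have k0 : 4 * h%:C ^+ 2 * c0 ^+ 2 = h%:C ^+ 2 * conjc alpha.
  by rewrite mulrAC sqr_c0 conj_alphaE mulrC.
set kappa := - expi phi; set mu := beta / normc alpha.
have -> : K * K = fps_const (c0 ^+ 2)
    * (1 - fps_const (2 * (kappa * mu%:C)) * fpsX _
    + fps_const (kappa ^+ 2) * (fpsX _ * fpsX _)).
  by rewrite -(@Rker_series_sqr _ _ _ _ erefl) rmorphXn /= /K; ring.
rewrite mulrA -rmorphM /= k0.
have -> : 2 * P + Q = fps_affine (2 + s%:C * ac) (2 + s%:C * a).
  have -> : 2 * P = fps_affine (2 * p0) (2 * (1 - 2 * (h ^+ 2 * theta)%:C * a)).
    rewrite mulr_natl mulr2n /P fps_affineD.
    by congr fps_affine; rewrite [RHS]mulr_natl [RHS]mulr2n.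
  rewrite fps_affineD /p0 /s.
  rewrite !(rmorphM, rmorphXn, rmorphB, rmorph_nat, rmorph1) /=.
  by congr fps_affine; ring.
have k1 : conjc alpha * (2 * (kappa * mu%:C)) = - (2 * beta%:C).
  rewrite e_conj /mu rmorphM fmorphV /=.
  rewrite -[RHS]mulr1 -(expiNM phi) /kappa; move: (normc alpha)%:C r0 => r.
  by move: (expi (- phi)) (expi phi) => w v r0; field.
have k2 : conjc alpha * kappa ^+ 2 = alpha.
  rewrite e_conj [RHS]e_alpha sqrrN expr2 -mulrA [expi (- phi) * _]mulrA expiNM.
  by rewrite mul1r.
move: (conjc alpha) conj_alphaE k1 k2 => ca caE k1 k2.
have expand (u v w : R[i]) (X Y : fps R[i]) :
    fps_const u * (1 - fps_const v * X + fps_const w * Y)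
    = fps_const u + fps_const (- (u * v)) * X + fps_const (u * w) * Y.
  by rewrite !(rmorphM, rmorphN) /=; ring.
rewrite /Q fps_affine_mul expand.
congr (fps_const _ + fps_const _ * _ + fps_const _ * _).
- by rewrite caE rmorphXn mulrA.
- by rewrite -[_ * ca * _]mulrA k1 betaE rmorphXn /=; ring.
- by rewrite -[_ * ca * _]mulrA k2 /alpha rmorphXn /=; ring.
Qed.

Let addMN : M + N = 2 * (P + Q).
Proof. by rewrite /M /N; ring. Qed.

Let MN : M * N = P * P.
Proof.
rewrite /M /N.
transitivity ((P + Q) * (P + Q) - fps_const (4 * h%:C ^+ 2) * (K * K)).
  by rewrite !(rmorphM, rmorph_nat); ring.
by rewrite kernel_sqr; ring.
Qed.

Let K0 : K 0%N = c0.
Proof. by rewrite /K fpsM0 Rker0 mulr1. Qed.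

(** |p0| is the geometric mean of |M(0)| and |N(0)|, and |M(0)| < |N(0)|. *)
Let PN : normc p0 < normc (N 0%N).
Proof.
have PQ0 : (P + Q) 0%N = p0 + q0 by rewrite /P /Q fps_affineD fps_affine0.
have N0E : N 0%N = p0 + q0 - 2 * h%:C * c0.
  by rewrite /N fpsDE PQ0 fpsNE fpsCM K0.
have M0E : M 0%N = p0 + q0 + 2 * h%:C * c0.
  by rewrite /M fpsDE PQ0 fpsCM K0.
have e : normc (M 0%N) * normc (N 0%N) = normc p0 ^+ 2.
  by rewrite -normcM -fpsM0 MN fpsM0 /P fps_affine0 normcM -expr2.
rewrite -(@ltr_pXn2r _ 2) ?nnegrE ?normc_ge0 // -e expr2.
move: decaying_root; rewrite -N0E -M0E => lt.
by rewrite ltr_pM2r // (le_lt_trans _ lt) ?normc_ge0.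
Qed.

Lemma decaying_dtbc J Psi m :
    decaying_solution theta h tau hbar rho B V J.+1 Psi ->
  dtbc_lhs theta h tau hbar rho B V J.+1 Psi m.+1
  = (hbar ^+ 2 / 2 * B)%:C * (K * (Psi J.+1 : fps R[i])) m.+1.
Proof.
move=> [Psi0 Psi_scheme Psi_sum]; pose y k : fps R[i] := Psi (J + k)%N.
have y0 k : y k 0%N = 0 by rewrite /y Psi0 // leq_addr.
have y_rec k : P * (y k.+2 + y k) = (M + N) * y k.+1.
  rewrite addMN.
  apply/funext => -[|l]; first by rewrite !fpsM0 fpsDE !y0 addr0 !mulr0.
  have := Psi_scheme (J + k.+1)%N l.+1.
  rewrite addnS ltnS leq_addr => /(_ isT isT).
  by move/scheme_seriesE; rewrite /y !addnS.
have y_bounded : coef_bounded y.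
  move=> l; have [b hb] := sqr_summable_bounded (Psi_sum l).
  (* The sum starts at the boundary node, k = 1; its left neighbour, k = 0, is bounded
     separately. *)
  exists (Num.max (normc (y 0%N l)) b) => -[|k]; rewrite le_max ?lexx //.
  by rewrite orbC /y addnS hb // ltnS leq_addr.
have := bounded_recurrence MN PN y_rec y_bounded 0.
rewrite /y addn0 addn1 => e.
rewrite dtbc_lhs_seriesE; congr (_ * _).
(* N y_1 = P y_0 turns the left-hand side into (P + Q - N) y_1. *)
have -> : P * ((Psi J.+1 : fps R[i]) - Psi J.+1.-1) + Q * (Psi J.+1 : fps R[i])
   = fps_const (2 * h%:C) * (K * (Psi J.+1 : fps R[i])).
  by rewrite mulrBr /= -e /N; ring.
by rewrite fpsCM mulrA mulVf ?mul1r // mulf_neq0 ?pnatr_eq0 // nz.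
Qed.

(** Every boundary history is attained, which determines the values of any exact boundary
    operator. *)
Lemma decaying_solution_exists J (Phi : nat -> R[i]) : Phi 0%N = 0 ->
  exists2 Psi, decaying_solution theta h tau hbar rho B V J.+1 Psi
    & Psi J.+1 = Phi.
Proof.
move=> /(@decaying_recurrence _ _ _ M N p0_neq0 MN PN).
move=> [y [y1 y0 y_rec [r r01 y_bound]]].
(* For j < J the truncated difference gives [y 0]; the conditions concern only nodes from J on. *)
exists (fun j => y (j - J)%N); last by rewrite -addn1 addKn.
split.
- by move=> j _; apply: y0.
- move=> j [//|m] Jj _; apply/scheme_seriesE.
  have [k ->] : exists k, j = (J + k.+1)%N.
    by exists (j - J.+1)%N; rewrite addnS -addSn subnKC.
  have -> : ((J + k.+1).+1 - J = k.+2)%N by rewrite -addnS addKn.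
  have -> : ((J + k.+1).-1 - J = k)%N by rewrite addnS addKn.
  rewrite addKn.
  by rewrite y_rec addMN.
move=> m; have [b hb] := y_bound m.
rewrite -nneseries_addn => [|j]; last by rewrite lee_fin sqr_ge0.
apply: (@nneseries_geometric_lty _ _ (b ^+ 2) (r ^+ 2)) => [|k].
  by move/andP: r01 => [r0 r1]; rewrite sqr_ge0 expr_lt1.
rewrite sqr_ge0 /= addnS subSn ?leq_addl // addnK.
rewrite exprAC -exprMn ler_sqr ?nnegrE ?normc_ge0 //.
exact: le_trans (normc_ge0 _) (hb k).
Qed.

Let K_dconv (Phi : nat -> R[i]) m :
  (K * (Phi : fps R[i])) m
  = c0 * dconv (Rker (- expi phi) (beta / normc alpha)) Phi m.
Proof. by rewrite /K -mulrA fpsCM fpsME /dconv big_mkord. Qed.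

Lemma Sref_dconv J (Phi : nat -> R[i]) m : Phi 0%N = 0 ->
  Sref theta h tau hbar rho B V J.+1 (history Phi m.+1)
  = c0 * dconv (Rker (- expi phi) (beta / normc alpha)) Phi m.+1.
Proof.
move=> Phi0.
(* Entry l of a history is the value at time l + 1; the value at time 0 is restored as 0, and times
   beyond n get 0. *)
pose unhistory n (H : {ffun 'I_n -> R[i]}) k : R[i] :=
  if k is l.+1 then oapp H 0 (insub l) else 0.
have unhistoryK n (Psi : nat -> R[i]) : Psi 0%N = 0 ->
    forall k, (k <= n)%N -> unhistory n (history Psi n) k = Psi k.
  by move=> Psi0 [|k] lekn //=; rewrite insubT /= ffunE.
pose S n H :=
  c0 * dconv (Rker (- expi phi) (beta / normc alpha)) (unhistory n H) n.
have SE n (Psi : nat -> R[i]) : Psi 0%N = 0 ->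
    S n (history Psi n) = (K * (Psi : fps R[i])) n.
  move=> Psi0; rewrite K_dconv; congr (_ * _); rewrite /dconv !big_mkord.
  by apply: eq_bigr => i _; rewrite unhistoryK // leq_subr.
have nz_hB : (hbar ^+ 2 / 2 * B)%:C != 0.
  by rewrite nz // !mulr_gt0 // ?invr_gt0 // exprn_gt0.
have S_exact : exact_dtbc theta h tau hbar rho B V J.+1 S.
  move=> Psi hPsi [//|n] _; rewrite decaying_dtbc // SE //.
  by have [Psi0 _ _] := hPsi; apply: Psi0.
have [Psi hPsi PsiJ] := @decaying_solution_exists J Phi Phi0.
(* [S] rules out the default of [xget]; any other exact [S'] is evaluated on the solution with
   boundary values [Phi]. *)
rewrite /Sref; case: xgetP => [S' _ S'_exact|/(_ S)//].
apply: (mulfI nz_hB); rewrite -K_dconv -PsiJ -(decaying_dtbc m hPsi).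
by rewrite -(S'_exact _ hPsi).
Qed.
End Kernel.
End Scheme.

Theorem proposition1 (R : realType) (theta h tau hbar rho B V : R) (J : nat)
    (htheta : theta <= 1 / 4) (hh : 0 < h) (htau : 0 < tau) (hhbar : 0 < hbar)
    (hrho : 0 < rho) (hB : 0 < B) (hJ : (1 <= J)%N) :
  let a0 : R := V / (hbar ^+ 2 * B) in
  let a1 : R := 2 * rho / (tau * hbar * B) in
  let a : R[i] := a0 +i* a1 in
  let alpha : R[i] := 2 * a + ((1 - 4 * theta) * h ^+ 2)%:C * a ^+ 2 in
  let beta : R := 2 * a0 + (1 - 4 * theta) * h ^+ 2 * normc a ^+ 2 in
  let c0 : R[i] :=
    - (Num.sqrt (normc alpha) / 2)%:C * expi (- (arg0 alpha / 2)) in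
  let mu : R := beta / normc alpha in
  0 < a1 /\
  alpha != 0 /\
  -1 < mu < 1 /\
  (forall phi : R, arg alpha phi ->
   let kappa : R[i] := - expi phi in
   forall Phi : nat -> R[i], Phi 0%N = 0 ->
   forall m : nat, (1 <= m)%N ->
     Sref theta h tau hbar rho B V J (history Phi m)
     = c0 * dconv (Rker kappa mu) Phi m).
Proof.
case: J hJ => // J _; split; first by rewrite divr_gt0 // !mulr_gt0.
split; first exact: alpha_neq0.
split; first exact: mu_bounds.
by move=> phi phiP kappa Phi Phi0 [//|m] _; apply: Sref_dconv.
Qed.
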